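(* Suppose $2^a$ is the largest power of $2$ dividing $n$, where $a\ge 1$. Suppose $\theta=(\alpha,\beta,\gamma)\in S_n\times S_n\times S_n$ is such that the length of each cycle in $\alpha$, $\beta$ and $\gamma$ is divisible by $2^a$. Then $\theta\notin\mathrm{Atp}(n)$.
   Context: A Latin square of order $n$ is an $n\times n$ array $L=L(i,j)$ with rows, columns and symbols indexed by $[n]=\{1,\dots,n\}$ such that the symbols in every row and in every column are distinct. A triple $(\alpha,\beta,\gamma)\in S_n\times S_n\times S_n$ is an autotopism of $L$ if $\gamma(L(i,j))=L(\alpha(i),\beta(j))$ for all $i,j\in[n]$. $\mathrm{Atp}(n)$ is the set of all triples that are an autotopism of at least one Latin square of order $n$. Fixed points count as cycles of length $1$. *)

(* Defs.v *)
From mathcomp Require Import all_boot all_fingroup.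
From mathcomp Require Import matrix.

Set Implicit Arguments.
Unset Strict Implicit.
Unset Printing Implicit Defensive.

(* Rows, columns and symbols are indexed by 'I_n = {0, ..., n-1} rather than
   {1, ..., n}. *)
Definition latin_square (n : nat) (L : 'M['I_n]_n) : bool :=
  [forall i, injectiveb (fun j => L i j)]
  && [forall j, injectiveb (fun i => L i j)].

Definition autotopism (n : nat) (L : 'M['I_n]_n)
    (alpha beta gamma : 'S_n) : bool :=
  [forall i, forall j, gamma (L i j) == L (alpha i) (beta j)].

Definition Atp (n : nat) : {set 'S_n * 'S_n * 'S_n} :=
  [set theta : 'S_n * 'S_n * 'S_n |
    [exists L : 'M['I_n]_n,
      latin_square L && autotopism L theta.1.1 theta.1.2 theta.2]].

(* [porbits s] is the set of supports of the cycles of s, a fixed point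
   contributing a singleton; so #|C| is the length of the cycle C. *)
Definition cycle_lengths_divisible_by (d n : nat) (s : 'S_n) : Prop :=
  forall C : {set 'I_n}, C \in porbits s -> d %| #|C|.

(* Main.v *)
Require Import Defs.
From mathcomp Require Import all_boot all_fingroup.
From mathcomp Require Import matrix.
From mathcomp Require Import ssralg zmodp.

(** Put [d = 2 ^ a] and [n = d * m] with [m] odd.  Since [d] divides all cycle
    lengths, rows, columns and symbols can be labelled by Z/d, through [r], [c]
    and [s], so that alpha, beta, gamma increase labels by 1; each label is then
    used [m] times.  Let [A] be the sum of [s (L i j) - c j] over the cells with
    [r i = 0].  Row by row, the symbol labels and the column labels have the
    same sum, so [A = 0].  On the other
    hand the summand is invariant under the autotopism, whose powers move the
    cells with labels [(0, - u)] to those with labels [(u, 0)]; so [A] is also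
    the sum over the cells with [c j = 0], which is [m ^ 2] times the sum of all
    elements of Z/d.  As [m] is odd and [d] even, this is not 0. *)

Set Implicit Arguments.
Unset Strict Implicit.
Unset Printing Implicit Defensive.

Import GRing.Theory.

Local Open Scope ring_scope.

(** The remainder of [p] modulo the cycle length [c] also returns [x] to itself, while the first [c]
    iterates of [x] are distinct; so the remainder is 0. *)
Lemma porbit_period (T : finType) (s : {perm T}) (x : T) (p : nat) :
  (s ^+ p)%g x = x -> (#|porbit s x| %| p)%N.
Proof.
set c := #|porbit s x| => sp_x.
have c_gt0 : (0 < c)%N by apply/card_gt0P; exists x; apply: porbit_id.
have sc_x : (s ^+ c)%g x = x by rewrite permX iter_porbit.
have sqc_x q : (s ^+ (q * c))%g x = x.
  by elim: q => [|q IHq]; rewrite ?perm1 // mulSn expgD permM sc_x.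
have sr_x : iter (p %% c) s x = x.
  by rewrite -permX -[RHS]sp_x {2}(divn_eq p c) expgD permM sqc_x.
have r_lt : (p %% c < c)%N by rewrite ltn_mod.
have := uniq_traject_porbit s x; rewrite -/c => /(nth_uniq x).
move=> /(_ (p %% c)%N 0%N); rewrite !size_traject !nth_traject //= sr_x eqxx.
by move=> /(_ r_lt c_gt0)/esym.
Qed.

Lemma porbit_expg_eq_mod (T : finType) (s : {perm T}) (x : T) (d p q : nat) :
  (d %| #|porbit s x|)%N -> (s ^+ p)%g x = (s ^+ q)%g x -> p = q %[mod d].
Proof.
move=> d_dvd; wlog le_qp : p q / (q <= p)%N => [hwlog|eq_pq].
  by case/orP: (leq_total q p) => /hwlog // h /esym/h/esym.
apply/eqP; rewrite eqn_mod_dvd //; apply: dvdn_trans d_dvd _.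
apply: porbit_period; apply: (@perm_inj _ (s ^+ q)%g).
by rewrite -permM -expgD subnK.
Qed.

(** Label [x] by an exponent [k] that leads from a base point of its cycle to [x]. Modulo [d] the
    choice of [k] is immaterial, as [d] divides the cycle length. *)
Lemma cyclic_labelling (T : finType) (s : {perm T}) (d : nat) :
  (1 < d)%N -> (forall C, C \in porbits s -> (d %| #|C|)%N) ->
  exists r : T -> 'Z_d, forall x, r (s x) = r x + 1.
Proof.
move=> d_gt1 d_dvd.
(* The orbit contains [x], so the default never occurs and [base x] depends on the orbit alone. *)
pose base x := odflt x [pick y in porbit s x].
have baseP x : exists k : nat, x == (s ^+ k)%g (base x).
  suff : x \in porbit s (base x) by case/porbitP => k /eqP; exists k.
  rewrite /base; case: pickP => [y|_] /=; last exact: porbit_id.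
  by rewrite porbit_sym.
have base_s x : base (s x) = base x.
  have eq_orb : porbit s (s x) = porbit s x.
    by apply/eqP; rewrite eq_porbit_mem -{1}[s]expg1 mem_porbit.
  by rewrite /base eq_orb; case: pickP => // /(_ x); rewrite porbit_id.
exists (fun x => (ex_minn (baseP x))%:R) => x.
case: ex_minnP => p /eqP; rewrite base_s => sp _.
case: ex_minnP => q /eqP sq _.
have /porbit_expg_eq_mod eq_mod : (s ^+ p)%g (base x) = (s ^+ (q + 1))%g (base x).
  by rewrite -sp expgD expg1 permM -sq.
have := eq_mod d (d_dvd _ (imset_f _ isT)).
move=> /(congr1 (fun k => k%:R : 'Z_d)); rewrite !Zp_nat_mod //.
by rewrite natrD.
Qed.

(** [s] maps each class bijectively onto the next, so the [d] classes share the [d * m] points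
    equally. *)
Lemma card_label_class (T : finType) (s : {perm T}) (d m : nat) (r : T -> 'Z_d) :
  (1 < d)%N -> #|T| = (d * m)%N -> (forall x, r (s x) = r x + 1) ->
  forall u, #|[pred x | r x == u]| = m.
Proof.
move=> d_gt1 cardT r_s.
have class_succ u : #|[pred x | r x == u + 1]| = #|[pred x | r x == u]|.
  rewrite -!sum1_card (reindex_inj (@perm_inj _ s)) /=.
  by apply: eq_bigl => x; rewrite !inE r_s (inj_eq (addIr 1)).
have class0 u : #|[pred x | r x == u]| = #|[pred x | r x == 0]|.
  rewrite -[u]natr_Zp; elim: (nat_of_ord u) => [|k IHk] //.
  by rewrite -natr1 class_succ.
move=> u; apply/eqP; rewrite class0 -(eqn_pmul2l (ltnW d_gt1)) -cardT.
rewrite -[#|T|]sum1_card (partition_big r predT) //=.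
under eq_bigr => v _ do
  rewrite sum1_card (eq_card (B := [pred x | r x == v])) // class0.
have card_Zd : #|'Z_d| = d by rewrite card_ord Zp_cast.
by rewrite sum_nat_const card_Zd.
Qed.

Lemma sum_labels (T : finType) (s : {perm T}) (d m : nat) (r : T -> 'Z_d) :
  (1 < d)%N -> #|T| = (d * m)%N -> (forall x, r (s x) = r x + 1) ->
  \sum_x r x = (\sum_(t : 'Z_d) t) *+ m.
Proof.
move=> d_gt1 cardT r_s; rewrite (partition_big r predT) //= -sumrMnl.
apply: eq_bigr => u _; rewrite -(card_label_class d_gt1 cardT r_s u) -sumr_const.
by apply: eq_bigr => x /eqP.
Qed.

Lemma sum_Zp_even_neq0 (d k : nat) :
  (1 < d)%N -> ~~ odd d -> coprime d k -> (\sum_(t : 'Z_d) t) *+ k != 0.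
Proof.
move=> d_gt1 d_even co_dk; apply/negP => /eqP.
have -> : \sum_(t : 'Z_d) t = 'C(d, 2)%:R.
  rewrite -bin2_sum natr_sum big_mkord.
  transitivity (\sum_(t < (Zp_trunc d).+2) (t : nat)%:R : 'Z_d).
    by apply: eq_bigr => t _; rewrite natr_Zp.
  by rewrite Zp_cast.
rewrite -mulrnA => /(congr1 val) /=; rewrite val_Zp_nat // => /eqP.
rewrite -/(dvdn d _) Gauss_dvdl // => /dvdnP[q bin_q].
(* From ['C(d, 2) = q * d] and [d * (d - 1) = 2 * 'C(d, 2)]; but [d - 1] is odd. *)
have : (2 * q = d.-1)%N.
  apply/eqP; rewrite -(eqn_pmul2l (ltnW d_gt1)) -[d.-1]bin1 mul_bin_diag.
  by rewrite bin_q mulnCA (mulnC d).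
move=> /(congr1 odd); rewrite oddM /=.
by move: d_even; rewrite -[in odd d](prednK (ltnW d_gt1)) /= negbK => ->.
Qed.

Lemma sum_over_label_classes (n d : nat) (alpha beta : 'S_n)
    (r c : 'I_n -> 'Z_d) (f : 'I_n -> 'I_n -> 'Z_d) :
  (forall i, r (alpha i) = r i + 1) -> (forall j, c (beta j) = c j + 1) ->
  (forall i j, f (alpha i) (beta j) = f i j) ->
  \sum_(i | r i == 0) \sum_j f i j = \sum_(j | c j == 0) \sum_i f i j.
Proof.
move=> r_a c_b f_ab.
pose S (u v : 'Z_d) := \sum_(i | r i == u) \sum_(j | c j == v) f i j.
have S_succ u v : S (u + 1) (v + 1) = S u v.
  rewrite /S (reindex_inj (@perm_inj _ alpha)) /=.
  apply: eq_big => [i|i _]; first by rewrite r_a (inj_eq (addIr 1)).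
  rewrite (reindex_inj (@perm_inj _ beta)) /=.
  by apply: eq_big => [j|j _]; rewrite ?c_b ?(inj_eq (addIr 1)) ?f_ab.
have S_shift u : S 0 (- u) = S u 0.
  (* Induction needs a natural number of diagonal steps; [u] is then read as its representative. *)
  suff shift (k : nat) : S (0 + k%:R) (- u + k%:R) = S 0 (- u).
    by rewrite -(shift u) natr_Zp add0r addNr.
  by elim: k => [|k IHk]; rewrite ?addr0 // -natr1 !addrA S_succ.
transitivity (\sum_u S 0 u).
  rewrite [RHS]exchange_big /=; apply: eq_bigr => i _.
  by rewrite (partition_big c predT).
rewrite (reindex_inj (@oppr_inj 'Z_d)) /=.
under eq_bigr => u _ do rewrite S_shift /S exchange_big.
rewrite exchange_big /=; apply: eq_bigr => j _.
by rewrite [RHS](partition_big r predT).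
Qed.

Lemma sum_Zp_of_autotopism (n d m : nat) (L : 'M['I_n]_n)
    (alpha beta gamma : 'S_n) (r c s : 'I_n -> 'Z_d) :
  (1 < d)%N -> n = (d * m)%N ->
  latin_square L -> autotopism L alpha beta gamma ->
  (forall i, r (alpha i) = r i + 1) -> (forall j, c (beta j) = c j + 1) ->
  (forall k, s (gamma k) = s k + 1) ->
  (\sum_(t : 'Z_d) t) *+ (m * m) = 0.
Proof.
move=> d_gt1 n_dm /andP[/forallP L_row /forallP L_col] L_auto r_a c_b s_g.
have cardI : #|'I_n| = (d * m)%N by rewrite card_ord.
have Ls i j : s (L (alpha i) (beta j)) = s (L i j) + 1.
  by move/forallP/(_ i)/forallP/(_ j)/eqP: L_auto => <-.
have sum_row i : \sum_j s (L i j) = \sum_k s k.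
  by rewrite [RHS](reindex_inj (injectiveP _ (L_row i))).
have sum_col j : \sum_i s (L i j) = \sum_k s k.
  by rewrite [RHS](reindex_inj (injectiveP _ (L_col j))).
pose f i j := s (L i j) - c j.
have f_ab i j : f (alpha i) (beta j) = f i j.
  by rewrite /f Ls c_b opprD addrACA subrr addr0.
have := sum_over_label_classes r_a c_b f_ab.
rewrite big1 => [|i _]; last first.
  by rewrite sumrB sum_row (sum_labels d_gt1 cardI s_g)
    (sum_labels d_gt1 cardI c_b) subrr.
move=> A_eq0; rewrite [RHS]A_eq0 mulrnA.
(* One factor [m] counts the columns labelled 0; the other comes from the symbol sum in each of
   them. *)
rewrite -[X in _ *+ X](card_label_class d_gt1 cardI c_b 0) -sumr_const.
apply: eq_bigr => j /eqP c_j; rewrite /f c_j.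
under [RHS]eq_bigr => i _ do rewrite subr0.
by rewrite sum_col (sum_labels d_gt1 cardI s_g).
Qed.

Local Close Scope ring_scope.

Theorem corollary5p3 (n a : nat) (alpha beta gamma : 'S_n)
    (ha : 1 <= a)
    (hdvd : 2 ^ a %| n)
    (hmax : forall b : nat, 2 ^ b %| n -> b <= a)
    (halpha : cycle_lengths_divisible_by (2 ^ a) alpha)
    (hbeta : cycle_lengths_divisible_by (2 ^ a) beta)
    (hgamma : cycle_lengths_divisible_by (2 ^ a) gamma) :
  (alpha, beta, gamma) \notin Atp n.
Proof.
have d_gt1 : 1 < 2 ^ a by rewrite -{1}(expn0 2) ltn_exp2l.
have [m n_dm] : exists m, n = 2 ^ a * m.
  by case/dvdnP: hdvd => m ->; exists m; rewrite mulnC.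
have m_odd : odd m.
  (* An even [m] would make [2 ^ a.+1] divide [n], against [hmax]. *)
  apply/negPn/negP; rewrite -dvdn2 => m_even.
  have := dvdn_mul (dvdnn (2 ^ a)) m_even.
  by rewrite -n_dm -expnSr => /hmax; rewrite ltnn.
have [r r_a] := cyclic_labelling d_gt1 halpha.
have [c c_b] := cyclic_labelling d_gt1 hbeta.
have [s s_g] := cyclic_labelling d_gt1 hgamma.
rewrite inE; apply/existsP => -[L /andP[L_latin L_auto]].
have /eqP := sum_Zp_of_autotopism d_gt1 n_dm L_latin L_auto r_a c_b s_g.
apply/negP; apply: sum_Zp_even_neq0 => //; first by rewrite oddX orbF -lt0n.
by rewrite coprimeXl // coprime2n oddM m_odd.
Qed.
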